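(* Let $G_1=(V_1,E_1)$ and $G_2=(V_2,E_2)$ be graphs. Then: (i) if $G_2$ is complete, $f(G_1\bullet G_2)=f(G_1)$ for each $f\in\{\mathrm{thin},\mathrm{pthin},\mathrm{compthin},\mathrm{comppthin}\}$; (ii) $f(G_1\bullet G_2)\leq f'(G_1)f(G_2)$ for each $(f,f')\in\{(\mathrm{thin},\mathrm{indthin}),(\mathrm{indthin},\mathrm{indthin}),(\mathrm{pthin},\mathrm{indpthin}),(\mathrm{indpthin},\mathrm{indpthin})\}$; (iii) $f(G_1\bullet G_2)\leq |V_1|f(G_2)$ for each $f\in\{\mathrm{compthin},\mathrm{comppthin}\}$; (iv) if $G_2$ is not complete, $\omega(G_1)f(G_2)\leq f(G_1\bullet G_2)$ for each $f\in\{\mathrm{thin},\mathrm{indthin},\mathrm{indpthin}\}$.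
   Context: Graphs are finite, simple, undirected; $\omega(G)$ is the clique number. The lexicographical product $G_1\bullet G_2$ has vertex set $V_1\times V_2$, and $(u_1,u_2)$, $(v_1,v_2)$ are adjacent iff either $u_1=v_1$ and $u_2v_2\in E_2$, or $u_1v_1\in E_1$. For a graph $G=(V,E)$, an ordering $v_1,\dots,v_n$ of $V$ and a partition of $V$ are consistent if for every $r<s<t$, whenever $v_r,v_s$ are in the same class and $v_tv_r\in E$, then $v_tv_s\in E$; strongly consistent if moreover for every $r<s<t$, whenever $v_s,v_t$ are in the same class and $v_tv_r\in E$, then $v_sv_r\in E$. $\mathrm{thin}(G)$ (resp. $\mathrm{pthin}(G)$) is the minimum number of classes of a partition of $V$ consistent (resp. strongly consistent) with some ordering of $V$. $\mathrm{indthin}$, $\mathrm{indpthin}$ are defined likewise requiring each class to be an independent set, and $\mathrm{compthin}$, $\mathrm{comppthin}$ requiring each class to be a clique. *)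

(* Defs.v *)
From HB Require Import structures.
From mathcomp Require Import all_boot.

Set Implicit Arguments.
Unset Strict Implicit.
Unset Printing Implicit Defensive.

Record sgraph := SGraph {
  vertex :> finType;
  edge : rel vertex;
  edge_sym : symmetric edge;
  edge_irrefl : irreflexive edge
}.

Arguments edge {G} x y : rename.

Definition clique (G : sgraph) (K : {set G}) : bool :=
  [forall x in K, forall y in K, (x != y) ==> edge x y].

Definition independent (G : sgraph) (S : {set G}) : bool :=
  [forall x in S, forall y in S, ~~ edge x y].

Definition complete (G : sgraph) : Prop :=
  forall x y : G, x != y -> edge x y.

Definition clique_number (G : sgraph) : nat :=
  \max_(K : {set G} | clique K) #|K|.

Section LexProduct.

Variables G1 G2 : sgraph.

Definition lex_edge : rel (G1 * G2)%type := fun u v =>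
  ((u.1 == v.1) && edge u.2 v.2) || edge u.1 v.1.

Lemma lex_edge_sym : symmetric lex_edge.
Proof.
by move=> u v; rewrite /lex_edge eq_sym edge_sym [edge u.1 v.1]edge_sym.
Qed.

Lemma lex_edge_irrefl : irreflexive lex_edge.
Proof. by move=> u; rewrite /lex_edge !edge_irrefl andbF. Qed.

Definition lexprod : sgraph := SGraph lex_edge_sym lex_edge_irrefl.

End LexProduct.

Section Thinness.

Variable G : sgraph.

Definition same_class (P : {set {set G}}) (x y : G) : bool :=
  [exists C in P, (x \in C) && (y \in C)].

(* An ordering of the vertices is an injective v : 'I_#|G| -> G (hence a
   bijection); injectivity is required in [admissible] below. *)
Definition consistent (v : {ffun 'I_#|G| -> G}) (P : {set {set G}}) : bool :=
  [forall r : 'I_#|G|, forall s : 'I_#|G|, forall t : 'I_#|G|,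
    [&& r < s, s < t, same_class P (v r) (v s) & edge (v t) (v r)]
      ==> edge (v t) (v s)].

Definition strongly_consistent
    (v : {ffun 'I_#|G| -> G}) (P : {set {set G}}) : bool :=
  consistent v P &&
  [forall r : 'I_#|G|, forall s : 'I_#|G|, forall t : 'I_#|G|,
    [&& r < s, s < t, same_class P (v s) (v t) & edge (v t) (v r)]
      ==> edge (v s) (v r)].

Definition admissible (compat : {ffun 'I_#|G| -> G} -> {set {set G}} -> bool)
    (cls : pred {set G}) (P : {set {set G}}) : bool :=
  [&& partition P [set: G], [forall C in P, cls C]
    & [exists v : {ffun 'I_#|G| -> G}, injectiveb v && compat v P]].

Definition admissible_size
    (compat : {ffun 'I_#|G| -> G} -> {set {set G}} -> bool)
    (cls : pred {set G}) (k : nat) : bool :=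
  [exists P, admissible compat cls P && (#|P| == k)].

Definition any_class : pred {set G} := predT.

(* The partition into singletons is always admissible, so each of the minima
   below is taken over a nonempty set. *)
Definition singletons : {set {set G}} := [set [set x] | x : G].

Lemma same_class_singletons (x y : G) : same_class singletons x y -> x = y.
Proof.
case/existsP=> C /andP[/imsetP[z _ ->]] /andP[].
by rewrite !inE => /eqP-> /eqP->.
Qed.

Lemma strongly_consistent_singletons (v : {ffun 'I_#|G| -> G}) :
  injectiveb v -> strongly_consistent v singletons.
Proof.
move/injectiveP=> vI; apply/andP; split;
  apply/forallP=> r; apply/forallP=> s; apply/forallP=> t; apply/implyP;
  by case/and4P=> rs st /same_class_singletons/vI E; rewrite E ltnn in rs st *.
Qed.

Lemma partition_singletons : partition singletons [set: G].
Proof.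
apply/and3P; split.
- apply/eqP/setP=> x; rewrite inE; apply/bigcupP.
  by exists [set x]; rewrite ?inE //; apply: imset_f.
- apply/trivIsetP=> A B /imsetP[x _ ->] /imsetP[y _ ->] xy.
  by rewrite disjoints1 inE; apply: contraNneq xy => ->.
- by apply/imsetP=> -[x _] /setP/(_ x); rewrite !inE eqxx.
Qed.

Lemma admissible_size_ex
    (compat : {ffun 'I_#|G| -> G} -> {set {set G}} -> bool)
    (cls : pred {set G}) :
  (forall v : {ffun 'I_#|G| -> G}, injectiveb v -> compat v singletons) ->
  (forall x, cls [set x]) ->
  exists k, admissible_size compat cls k.
Proof.
move=> Hcompat Hcls; exists #|singletons|; apply/existsP; exists singletons.
rewrite eqxx andbT; apply/and3P; split; first exact: partition_singletons.
  by apply/forallP=> C; apply/implyP=> /imsetP[x _ ->].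
apply/existsP; exists [ffun i => enum_val i].
have vI : injectiveb [ffun i : 'I_#|G| => enum_val i].
  by apply/injectiveP=> i j; rewrite !ffunE => /enum_val_inj.
by rewrite vI Hcompat.
Qed.

Lemma consistent_singletons (v : {ffun 'I_#|G| -> G}) :
  injectiveb v -> consistent v singletons.
Proof. by case/strongly_consistent_singletons/andP. Qed.

Lemma any_class1 (x : G) : any_class [set x].
Proof. by []. Qed.

Lemma independent1 (x : G) : independent [set x].
Proof.
apply/forallP=> y; apply/implyP=> /set1P->.
by apply/forallP=> z; apply/implyP=> /set1P->; rewrite edge_irrefl.
Qed.

Lemma clique1 (x : G) : clique [set x].
Proof.
apply/forallP=> y; apply/implyP=> /set1P->.
by apply/forallP=> z; apply/implyP=> /set1P->; rewrite eqxx.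
Qed.

Definition thin : nat :=
  ex_minn (admissible_size_ex consistent_singletons any_class1).

Definition pthin : nat :=
  ex_minn (admissible_size_ex strongly_consistent_singletons any_class1).

Definition indthin : nat :=
  ex_minn (admissible_size_ex consistent_singletons independent1).

Definition indpthin : nat :=
  ex_minn (admissible_size_ex strongly_consistent_singletons independent1).

Definition compthin : nat :=
  ex_minn (admissible_size_ex consistent_singletons clique1).

Definition comppthin : nat :=
  ex_minn (admissible_size_ex strongly_consistent_singletons clique1).

End Thinness.

(* Main.v *)
Require Import Defs.
From mathcomp Require Import all_boot.
From mathcomp Require Import zify.

Set Implicit Arguments.
Unset Strict Implicit.
Unset Printing Implicit Defensive.

(** Upper bounds come from ordering [G1 * G2] lexicographically.  For (iv),
    restrict an optimal layout of the product to the copies of [G2] over a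
    maximum clique of [G1].  Distinct copies are completely joined, so if a
    class contains vertices [x < y] of different copies, then [y] is adjacent
    to every later vertex of its own copy.  In a single copy such vertices can
    be moved to the end of the order and recoloured arbitrarily, and since
    [G2] is not complete some vertex is left to lend its colour.  Hence the
    copy over [a] needs only the classes holding one of its remaining
    vertices, and each class does so for at most one [a]. *)

(** * Partitions and orderings encoded by colours and ranks *)

Section Layout.

Variable G : sgraph.

(** One notion serves all six parameters: [st] switches on the strong condition, and [e] is what any
    two vertices of a class must satisfy. Ranks need only be injective, not consecutive, so a layout
    can be restricted to a subgraph or have vertices moved without renumbering. *)
Definition layout (st : bool) (e : rel G) (T : Type)
    (rho : G -> nat) (c : G -> T) : Prop :=
  [/\ injective rho,
      forall x y z, rho x < rho y -> rho y < rho z ->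
        c x = c y -> edge z x -> edge z y,
      st -> forall x y z, rho x < rho y -> rho y < rho z ->
        c y = c z -> edge z x -> edge y x
    & forall x y, c x = c y -> e x y].

Definition class_of_rel (e : rel G) (C : {set G}) : bool :=
  [forall x in C, forall y in C, e x y].

Definition compat_of (st : bool) (v : {ffun 'I_#|G| -> G})
    (P : {set {set G}}) : bool :=
  if st then strongly_consistent v P else consistent v P.

Lemma consistentP (v : {ffun 'I_#|G| -> G}) (P : {set {set G}}) :
  reflect (forall r s t : 'I_#|G|, r < s -> s < t ->
             same_class P (v r) (v s) -> edge (v t) (v r) -> edge (v t) (v s))
          (consistent v P).
Proof.
apply: (iffP forallP) => [H r s t rs st sc E | H r].
  by move/forallP: (H r) => /(_ s) /forallP/(_ t); rewrite rs st sc E.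
by apply/forallP=> s; apply/forallP=> t; apply/implyP=> /and4P[]; apply: H.
Qed.

Lemma strongly_consistentP (v : {ffun 'I_#|G| -> G}) (P : {set {set G}}) :
  reflect (consistent v P /\ forall r s t : 'I_#|G|, r < s -> s < t ->
             same_class P (v s) (v t) -> edge (v t) (v r) -> edge (v s) (v r))
          (strongly_consistent v P).
Proof.
apply: (iffP andP) => -[cv H]; split=> //.
  move=> r s t rs st sc E.
  by move/forallP: H => /(_ r) /forallP/(_ s) /forallP/(_ t); rewrite rs st sc E.
apply/forallP=> r; apply/forallP=> s; apply/forallP=> t.
by apply/implyP=> /and4P[]; apply: H.
Qed.

Lemma ordering_of_rank (rho : G -> nat) : injective rho ->
  exists2 v : {ffun 'I_#|G| -> G}, injective v &
    forall i j : 'I_#|G|, i < j -> rho (v i) < rho (v j).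
Proof.
move=> rhoI.
(* [nth] needs a default vertex, so the empty graph is treated apart. *)
have [x0 _ | G0] := pickP G; last first.
  have abs (i : 'I_#|G|) : False by case: i => i; rewrite (eq_card0 G0).
  by exists [ffun i => enum_val i] => i; case: (abs i).
pose s := sort (relpre rho leq) (enum G).
have sz : size s = #|G| by rewrite size_sort cardE.
have ss : sorted (relpre rho leq) s.
  by apply: sort_sorted => x y; apply: leq_total.
have us : uniq s by rewrite sort_uniq enum_uniq.
have vI : injective [ffun i : 'I_#|G| => nth x0 s i].
  move=> i j; rewrite !ffunE => /eqP; rewrite nth_uniq ?sz //.
  by move/eqP/val_inj.
exists [ffun i : 'I_#|G| => nth x0 s i] => // i j ij.
rewrite ltn_neqAle; apply/andP; split.
  apply: contraTneq ij => /rhoI /vI ->; by rewrite ltnn.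
rewrite !ffunE.
have tr : transitive (relpre rho leq) by move=> a b d; apply: leq_trans.
by apply: (sorted_ltn_nth tr x0 ss); rewrite ?inE ?sz.
Qed.

Lemma same_class_preim (T : eqType) (c : G -> T) (x y : G) :
  same_class (preim_partition c [set: G]) x y -> c x = c y.
Proof.
case/existsP=> C /andP[CP /andP[xC yC]].
have [_ tP _] := and3P (preim_partitionP c [set: G]).
have := pblock_equivalence_partition (R := fun x y => c x == c y) (D := [set: G]).
move=> H; apply/eqP; rewrite -H ?inE //.
  by rewrite (def_pblock tP CP xC).
by move=> a b d _ _ _; split=> // /eqP ->.
Qed.

(** The classes are the nonempty fibres of [c]. Colours of [A] taken by no vertex yield no class,
    hence only [k <= #|A|]. *)
Lemma admissible_of_layout (st : bool) (e : rel G) (cls : pred {set G})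
    (T : finType) (A : {set T}) (rho : G -> nat) (c : G -> T) :
  cls =1 class_of_rel e -> layout st e rho c -> (forall x, c x \in A) ->
  exists2 k, k <= #|A| & admissible_size (compat_of st) cls k.
Proof.
move=> clsE [rhoI cons scons ce] cA; set P := preim_partition c [set: G].
exists #|P|.
  apply: leq_trans (leq_imset_card (fun t => [set y in [set: G] | t == c y]) A).
  apply/subset_leq_card/subsetP=> _ /imsetP[x _ ->].
  by apply/imsetP; exists (c x).
apply/existsP; exists P; rewrite eqxx andbT.
apply/and3P; split; first exact: preim_partitionP.
  apply/forallP=> C; apply/implyP=> CP; rewrite clsE.
  apply/forallP=> x; apply/implyP=> xC; apply/forallP=> y; apply/implyP=> yC.
  by apply/ce/same_class_preim/existsP; exists C; rewrite CP xC.
have [v vI vr] := ordering_of_rank rhoI.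
apply/existsP; exists v; apply/andP; split; first exact/injectiveP.
have cv : consistent v P.
  by apply/consistentP=> r s t /vr rs /vr s_t /same_class_preim; apply: cons.
rewrite /compat_of; case: st scons => // /(_ isT) scons.
apply/strongly_consistentP; split=> // r s t /vr rs /vr s_t /same_class_preim.
exact: scons.
Qed.

Lemma layout_of_admissible (st : bool) (e : rel G) (cls : pred {set G}) (k : nat) :
  cls =1 class_of_rel e -> admissible_size (compat_of st) cls k ->
  exists (P : {set {set G}}) (rho : G -> nat) (c : G -> {set G}),
    [/\ layout st e rho c, forall x, rho x < #|G|, forall x, c x \in P
      & #|P| = k].
Proof.
move=> clsE /existsP[P /andP[/and3P[partP clsP /existsP[v /andP[/injectiveP vI cv]]] /eqP Pk]].
have [covP tP _] := and3P partP.
have inP x : pblock P x \in P by rewrite pblock_mem // (eqP covP).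
have inB x : x \in pblock P x by rewrite mem_pblock (eqP covP).
have sc x y : pblock P x = pblock P y -> same_class P x y.
  move=> E; apply/existsP; exists (pblock P x); by rewrite inP inB E inB.
have [w vw wv] : bijective v by apply: inj_card_bij => //; rewrite card_ord.
exists P, (fun x => val (w x)), (pblock P); split=> // [|x]; last exact: ltn_ord.
split.
- by move=> x y /val_inj /(can_inj wv).
- move=> x y z xy yz /sc; rewrite -{1 2}(wv x) -{1 2}(wv y) -(wv z).
  have /consistentP : consistent v P.
    by move: cv; rewrite /compat_of; case: st => // /andP[].
  by apply; rewrite ?wv.
- move=> st1; move: cv; rewrite /compat_of st1 => /strongly_consistentP[_ H] x y z xy yz /sc.
  by rewrite -{1 2}(wv y) -{1 2}(wv z) -{1 2}(wv x); apply: H; rewrite ?wv.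
- move=> x y E; move/forallP/(_ _)/implyP/(_ (inP x)): clsP.
  rewrite clsE => /forallP/(_ x); rewrite inB => /forallP/(_ y).
  by rewrite E inB.
Qed.

(** The first half turns a constructed layout into an upper bound on [n]; the second supplies an
    optimal layout. Its ranks stay below [#|G|], which provides the radix of the lexicographic order
    and the offset for moving vertices to the end. *)
Definition min_layout (st : bool) (e : rel G) (n : nat) : Prop :=
  (forall (T : finType) (A : {set T}) (rho : G -> nat) (c : G -> T),
     layout st e rho c -> (forall x, c x \in A) -> n <= #|A|) /\
  (exists (T : finType) (A : {set T}) (rho : G -> nat) (c : G -> T),
    [/\ layout st e rho c, forall x, rho x < #|G|, forall x, c x \in A
      & #|A| = n]).

Lemma ex_minn_min_layout (st : bool) (e : rel G) (cls : pred {set G})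
    (ex : exists k, admissible_size (compat_of st) cls k) :
  cls =1 class_of_rel e -> min_layout st e (ex_minn ex).
Proof.
move=> clsE; case: ex_minnP => n adm_n min_n; split.
  move=> T A rho c lay cA.
  have [k kA /min_n nk] := admissible_of_layout clsE lay cA.
  exact: leq_trans nk kA.
have [P [rho [c H]]] := layout_of_admissible clsE adm_n.
by exists {set G}, P, rho, c.
Qed.

Definition free_rel : rel G := fun _ _ => true.
Definition nonadjacent : rel G := fun x y => ~~ edge x y.
(** Equality is allowed because [layout] also compares a vertex with itself. *)
Definition adjacent_or_eq : rel G := fun x y => (x != y) ==> edge x y.

Lemma any_class_of_rel : @any_class G =1 class_of_rel free_rel.
Proof.
move=> C; symmetry; apply/forallP=> x; apply/implyP=> _; apply/forallP=> y.
exact/implyP.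
Qed.

Lemma thin_min_layout : min_layout false free_rel (thin G).
Proof. exact: (@ex_minn_min_layout false _ _ _ any_class_of_rel). Qed.

Lemma pthin_min_layout : min_layout true free_rel (pthin G).
Proof. exact: (@ex_minn_min_layout true _ _ _ any_class_of_rel). Qed.

Lemma indthin_min_layout : min_layout false nonadjacent (indthin G).
Proof. exact: (@ex_minn_min_layout false). Qed.

Lemma indpthin_min_layout : min_layout true nonadjacent (indpthin G).
Proof. exact: (@ex_minn_min_layout true). Qed.

Lemma compthin_min_layout : min_layout false adjacent_or_eq (compthin G).
Proof. exact: (@ex_minn_min_layout false). Qed.

Lemma comppthin_min_layout : min_layout true adjacent_or_eq (comppthin G).
Proof. exact: (@ex_minn_min_layout true). Qed.

End Layout.

Lemma layout_induced (G H : sgraph) (h : G -> H) (st : bool)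
    (e : rel G) (e' : rel H) (T : Type) (rho : H -> nat) (c : H -> T) :
  injective h -> (forall x y, edge (h x) (h y) = edge x y) ->
  (forall x y, e' (h x) (h y) -> e x y) ->
  layout st e' rho c -> layout st e (rho \o h) (c \o h).
Proof.
move=> hI hE he [rhoI cons scons ce]; split=> /=.
- exact: inj_comp.
- by move=> x y z xy yz cxy; rewrite -!hE; apply: cons.
- by move=> st1 x y z xy yz cyz; rewrite -!hE; apply: scons.
- by move=> x y /ce /he.
Qed.

(** * Lexicographic orderings of the product *)

Section LexUpper.

Variables (G1 G2 : sgraph) (st : bool) (rho1 : G1 -> nat) (rho2 : G2 -> nat).
Hypotheses (rho1I : injective rho1) (rho2I : injective rho2).
Hypothesis rho2_lt : forall x, rho2 x < #|G2|.

(** A two-digit number in base [#|G2|]: by [rho2_lt] the second digit never carries. *)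
Definition lex_rank (u : lexprod G1 G2) : nat := rho1 u.1 * #|G2| + rho2 u.2.

Lemma lex_rank_lt u v : lex_rank u < lex_rank v ->
  (rho1 u.1 < rho1 v.1) \/ (u.1 = v.1 /\ rho2 u.2 < rho2 v.2).
Proof.
rewrite /lex_rank; have := rho2_lt u.2; have := rho2_lt v.2.
case: (ltngtP (rho1 u.1) (rho1 v.1)) => [|vu v_lt u_lt|/rho1I -> _ _]; first by left.
  nia.
by rewrite ltn_add2l; right.
Qed.

Lemma lex_rank_inj : injective lex_rank.
Proof.
move=> [a x] [b y]; rewrite /lex_rank /= => E.
have [ltx lty] := (rho2_lt x, rho2_lt y).
have G2_gt0 : 0 < #|G2| by apply: leq_ltn_trans ltx.
have ab : rho1 a = rho1 b.
  move/(congr1 (divn^~ #|G2|)): E => /=.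
  by rewrite !divnMDl // !divn_small // !addn0.
by congr (_, _); [apply: rho1I | apply: rho2I; lia].
Qed.

(** Each copy of [G2] takes the colour of its base vertex. If the two vertices to be proved adjacent
    share a copy, completeness of [G2] applies; if the two of equal colour share a copy without the
    third, the third sees both alike; three distinct copies reduce to [G1]. *)
Lemma layout_lex_complete (e1 : rel G1) (e : rel (lexprod G1 G2)) (T : Type)
    (c1 : G1 -> T) :
  complete G2 -> layout st e1 rho1 c1 ->
  (forall u v, e1 u.1 v.1 -> e u v) ->
  layout st e lex_rank (fun u => c1 u.1).
Proof.
move=> G2c [_ cons scons ce] He; split; first exact: lex_rank_inj.
- move=> [a x] [b y] [d z] /lex_rank_lt /= xy /lex_rank_lt /= yz cxy.
  rewrite /edge /= /lex_edge /=.
  case: yz => [bd | [<- yz] _]; last first.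
    by rewrite eqxx G2c //; apply: contraTneq yz => ->; lia.
  case: xy => [ab | [E _]]; last subst b.
    have -> : (d == a) = false by apply: contraTF bd => /eqP ->; lia.
    by move/(cons _ _ _ ab bd cxy) => /= ->; rewrite orbT.
  have -> // : (d == a) = false by apply: contraTF bd => /eqP ->; lia.
- move=> st1 [a x] [b y] [d z] /lex_rank_lt /= xy /lex_rank_lt /= yz cyz.
  rewrite /edge /= /lex_edge /=.
  case: xy => [ab | [<- xy] _]; last first.
    by rewrite eqxx G2c //; apply: contraTneq xy => ->; lia.
  case: yz => [bd | [<- _]].
    have -> : (d == a) = false by apply: contraTF bd => /eqP ->; lia.
    by move/(scons st1 _ _ _ ab bd cyz) => /= ->; rewrite orbT.
  have -> // : (b == a) = false by apply: contraTF ab => /eqP ->; lia.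
- by move=> u v /ce /He.
Qed.

(** In the critical triples, the two vertices to be proved adjacent share a copy and the remaining
    one lies in another. It has the colour of one of them, so both copies lie over a single
    independent class of [G1] and the assumed edge cannot exist. All other triples are settled
    within one factor or by equal adjacency. *)
Lemma layout_lex_independent (e2 : rel G2) (e : rel (lexprod G1 G2))
    (T1 T2 : Type) (c1 : G1 -> T1) (c2 : G2 -> T2) :
  layout st (@nonadjacent G1) rho1 c1 -> layout st e2 rho2 c2 ->
  (forall u v, c1 u.1 = c1 v.1 -> e2 u.2 v.2 -> e u v) ->
  layout st e lex_rank (fun u => (c1 u.1, c2 u.2)).
Proof.
move=> [_ cons1 scons1 ce1] [_ cons2 scons2 ce2] He.
split; first exact: lex_rank_inj.
- move=> [a x] [b y] [d z] /lex_rank_lt /= xy /lex_rank_lt /= yz [cab cxy].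
  rewrite /edge /= /lex_edge /=.
  case: xy => [ab | [E xy]]; [|subst b]; case: yz => [bd | [<- yz]].
  + have -> : (d == a) = false by apply: contraTF bd => /eqP ->; lia.
    by move/(cons1 _ _ _ ab bd cab) => /= ->; rewrite orbT.
  + have -> : (b == a) = false by apply: contraTF ab => /eqP ->; lia.
    by rewrite /= (negbTE (ce1 _ _ (esym cab))).
  + have -> // : (d == a) = false by apply: contraTF bd => /eqP ->; lia.
  + by rewrite eqxx !edge_irrefl !orbF; apply: cons2.
- move=> st1 [a x] [b y] [d z] /lex_rank_lt /= xy /lex_rank_lt /= yz [cbd cyz].
  rewrite /edge /= /lex_edge /=.
  case: xy => [ab | [F xy]]; [|subst b]; case: yz => [bd | [E yz]].
  + have -> : (d == a) = false by apply: contraTF bd => /eqP ->; lia.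
    by move/(scons1 st1 _ _ _ ab bd cbd) => /= ->; rewrite orbT.
  + rewrite -E; have -> // : (b == a) = false by apply: contraTF ab => /eqP ->; lia.
  + have -> : (d == a) = false by apply: contraTF bd => /eqP ->; lia.
    by rewrite /= (negbTE (ce1 _ _ (esym cbd))).
  + by rewrite -E eqxx !edge_irrefl !orbF; apply: scons2.
- by move=> u v [] /He H /ce2 /H.
Qed.

End LexUpper.

(** [U] collects the vertices adjacent to every later vertex; they go to the end in their old
    relative order. If the middle vertex of a triple is moved, so is the last, and membership in [U]
    gives the edge whatever the colours, so recolouring is harmless. If only the last is moved,
    either it already came after the middle one and the old layout applies, or it came before and is
    adjacent to it by membership in [U]. *)
Lemma layout_move_dominating (G : sgraph) (T : Type) (rho : G -> nat) (c : G -> T)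
    (M : nat) (x0 : G) :
  let U := [pred y | [forall z, (rho y < rho z) ==> edge z y]] in
  (forall x, rho x < M) -> layout false (@free_rel G) rho c ->
  layout false (@free_rel G) (fun x => if U x then M + rho x else rho x)
    (fun x => c (if U x then x0 else x)).
Proof.
move=> U rhoM [rhoI cons _ _].
have UE y z : U y -> rho y < rho z -> edge z y.
  by move=> /forallP/(_ z)/implyP H /H.
split=> // [x y | x y z].
  have := rhoM x; have := rhoM y.
  by case: (U x); case: (U y) => ltx lty E; apply: rhoI; lia.
have := rhoM x; have := rhoM y; have := rhoM z.
case Uy: (U y); case Uz: (U z) => ltz lty ltx; try lia.
- by move=> _ yz _ _; apply: UE => //; lia.
- case Ux: (U x) => xy _ cxy zx; first lia.
  case: (ltngtP (rho y) (rho z)) => [yz | zy | /rhoI E].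
  + exact: cons cxy zx.
  + by rewrite edge_sym; apply: UE.
  + by rewrite -E Uy in Uz.
- case Ux: (U x) => xy yz cxy zx; first lia.
  exact: cons cxy zx.
Qed.

Lemma leq_mul_card_disjoint (I T : finType) (K : {set I}) (A : {set T})
    (D : I -> {set T}) (n : nat) :
  {in K, forall a, D a \subset A} -> {in K, forall a, n <= #|D a|} ->
  {in K &, forall a b t, t \in D a -> t \in D b -> a = b} ->
  #|K| * n <= #|A|.
Proof.
move=> DA nD Ddisj.
apply: (@leq_trans (\sum_(a in K) #|D a|)).
  by rewrite -sum_nat_const; apply: leq_sum.
(* [partition_disjoint_bigcup] wants disjointness over all indices, so the family is made empty
   outside [K]. *)
pose F a := if a \in K then D a else set0.
have Fd a b : a != b -> [disjoint F a & F b].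
  move=> ab; rewrite -setI_eq0; apply/set0Pn=> -[t]; rewrite inE /F.
  case: ifP; last by rewrite inE.
  case: ifP => [bK aK /andP[ta tb]|]; last by rewrite inE andbF.
  by rewrite (Ddisj _ _ aK bK _ ta tb) eqxx in ab.
have := partition_disjoint_bigcup addn (fun=> 1) Fd.
rewrite sum1_card => E.
have -> : \sum_(a in K) #|D a| = #|\bigcup_i F i|.
  rewrite E big_mkcond /=; apply: eq_bigr => a _.
  by rewrite sum1_card /F; case: ifP; rewrite ?cards0.
apply/subset_leq_card/bigcupsP=> a _; rewrite /F; case: ifP => [/DA //|_].
exact: sub0set.
Qed.

(** Induction on the maximum replaces the choice of a maximum clique; the lower bounds are then
    proved for an arbitrary clique [K]. *)
Lemma leq_clique_number_mul (G : sgraph) (n m : nat) :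
  (forall K : {set G}, clique K -> #|K| * n <= m) -> clique_number G * n <= m.
Proof.
move=> H; rewrite /clique_number.
by elim/big_ind: _ => // x y; case: (leqP x y).
Qed.

Lemma cliqueP (G : sgraph) (K : {set G}) :
  reflect {in K &, forall x y, x != y -> edge x y} (clique K).
Proof.
apply: (iffP forallP) => [H x y xK yK xy | H x].
  by move/implyP: (H x) => /(_ xK) /forallP/(_ y); rewrite yK xy.
apply/implyP=> xK; apply/forallP=> y; apply/implyP=> yK; apply/implyP.
exact: H.
Qed.

(** * Bounds for the parameters of the product *)

Section LexProductBounds.

Variables G1 G2 : sgraph.

Lemma edge_lex (a b : G1) (x y : G2) :
  edge ((a, x) : lexprod G1 G2) (b, y) = (a == b) && edge x y || edge a b.
Proof. by []. Qed.

(** Colouring copies by base vertex gives one inequality; restricting an optimal layout of the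
    product to the copy of [G1] at some [x0] gives the other, whence the nonemptiness of [G2]. *)
Lemma lex_complete_eq (st : bool) (e : rel (lexprod G1 G2)) (e1 : rel G1) (n n1 : nat) :
  0 < #|G2| -> complete G2 ->
  (forall u v, e1 u.1 v.1 -> e u v) ->
  (forall a b x, e (a, x) (b, x) -> e1 a b) ->
  min_layout st e n -> min_layout st e1 n1 -> n = n1.
Proof.
move=> /card_gt0P[x0 _] G2c He He1 [n_le [T [A [rho [c [lay _ cA An]]]]]].
move=> [n1_le [T1 [A1 [rho1 [c1 [lay1 _ cA1 An1]]]]]].
apply/eqP; rewrite eqn_leq; apply/andP; split.
  rewrite -An1.
  (* Any ordering of a complete graph will do; the enumeration order is taken. *)
  have r2I : injective (fun x : G2 => val (enum_rank x)).
    by move=> x y /val_inj /enum_rank_inj.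
  have r2lt (x : G2) : val (enum_rank x) < #|G2| by apply: ltn_ord.
  have r1I : injective rho1 by case: lay1.
  by apply: n_le (layout_lex_complete r1I r2I r2lt G2c lay1 He) _ => u.
rewrite -An.
have hI : injective (fun a => (a, x0) : lexprod G1 G2) by move=> a b [].
have hE a b : edge ((a, x0) : lexprod G1 G2) (b, x0) = edge a b.
  by rewrite edge_lex edge_irrefl andbF.
by apply: n1_le (layout_induced hI hE (fun a b => @He1 a b x0) lay) _ => a /=.
Qed.

Lemma lex_independent_leq (st : bool) (e : rel (lexprod G1 G2)) (e2 : rel G2)
    (n n1 n2 : nat) :
  (forall u v, ~~ edge u.1 v.1 -> e2 u.2 v.2 -> e u v) ->
  min_layout st e n -> min_layout st (@nonadjacent G1) n1 ->
  min_layout st e2 n2 -> n <= n1 * n2.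
Proof.
move=> He [n_le _] [_ [T1 [A1 [rho1 [c1 [lay1 _ cA1 <-]]]]]].
move=> [_ [T2 [A2 [rho2 [c2 [lay2 rho2lt cA2 <-]]]]]].
rewrite -cardsX.
have [r1I _ _ ce1] := lay1; have [r2I _ _ _] := lay2.
have He' (u v : lexprod G1 G2) : c1 u.1 = c1 v.1 -> e2 u.2 v.2 -> e u v.
  by move/ce1; apply: He.
apply: n_le (layout_lex_independent r1I r2I rho2lt lay1 lay2 He') _ => u.
by rewrite inE /= cA1 cA2.
Qed.

(** Singletons form an independent partition of [G1] with [#|G1|] classes. Equal colours then force
    equal copies, so a clique class of [G2] remains a clique in the product. *)
Lemma lex_card_leq (st : bool) (n n2 : nat) :
  min_layout st (@adjacent_or_eq (lexprod G1 G2)) n ->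
  min_layout st (@adjacent_or_eq G2) n2 -> n <= #|G1| * n2.
Proof.
move=> [n_le _] [_ [T2 [A2 [rho2 [c2 [lay2 rho2lt cA2 <-]]]]]].
have r1I : injective (fun x : G1 => val (enum_rank x)).
  by move=> x y /val_inj /enum_rank_inj.
have lay1 : layout st (@nonadjacent G1) (fun x => val (enum_rank x)) id.
  split=> //.
  - by move=> x y z xy _ E; rewrite E ltnn in xy.
  - by move=> _ x y z _ yz E; rewrite E ltnn in yz.
  - by move=> x y ->; rewrite /nonadjacent edge_irrefl.
have r2I : injective rho2 by case: lay2.
have He (u v : lexprod G1 G2) :
    u.1 = v.1 -> adjacent_or_eq u.2 v.2 -> adjacent_or_eq u v.
  case: u v => [a x] [b y] /= <-; rewrite /adjacent_or_eq edge_lex eqxx /=.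
  rewrite xpair_eqE eqxx /=; case: (x == y) => //= ->.
  by [].
rewrite -cardsT -cardsX.
apply: n_le (layout_lex_independent r1I r2I rho2lt lay1 lay2 He) _ => u.
by rewrite !inE /= cA2.
Qed.

(** Copies over distinct vertices of a clique are completely joined, so no independent class meets
    two of them; each copy alone uses at least [n2] classes. *)
Lemma clique_mul_independent_leq (st : bool) (n n2 : nat) :
  min_layout st (@nonadjacent (lexprod G1 G2)) n ->
  min_layout st (@nonadjacent G2) n2 -> clique_number G1 * n2 <= n.
Proof.
move=> [_ [T [A [rho [c [lay _ cA <-]]]]]] [n2_le _].
apply: leq_clique_number_mul => K /cliqueP clK.
pose D a := [set c (a, x) | x : G2].
apply: (@leq_mul_card_disjoint _ _ _ _ D).
- by move=> a _; apply/subsetP=> _ /imsetP[x _ ->].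
- move=> a _.
  have hI : injective (fun x => (a, x) : lexprod G1 G2) by move=> x y [].
  have hE x y : edge ((a, x) : lexprod G1 G2) (a, y) = edge x y.
    by rewrite edge_lex eqxx edge_irrefl orbF.
  have he x y : nonadjacent ((a, x) : lexprod G1 G2) (a, y) -> nonadjacent x y.
    by rewrite /nonadjacent hE.
  apply: n2_le (layout_induced hI hE he lay) _ => x /=.
  by apply/imsetP; exists x.
- move=> a b aK bK _ /imsetP[x _ ->] /imsetP[y _].
  case: lay => _ _ _ ce /ce; rewrite /nonadjacent edge_lex.
  by case: (eqVneq a b) => // ab; rewrite clK // orbT.
Qed.

Lemma clique_mul_thin_leq :
  ~ complete G2 -> clique_number G1 * thin G2 <= thin (lexprod G1 G2).
Proof.
move=> G2nc.
have [_ [T [A [rho [c [lay rho_lt cA <-]]]]]] := thin_min_layout (lexprod G1 G2).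
have [n2_le _] := thin_min_layout G2.
apply: leq_clique_number_mul => K /cliqueP clK.
have [rhoI cons _ _] := lay.
pose U a := [pred y | [forall z, (rho (a, y) < rho (a, z)) ==> edge z y]].
pose D a := [set c (a, y) | y in predC (U a)].
apply: (@leq_mul_card_disjoint _ _ _ _ D).
- by move=> a _; apply/subsetP=> _ /imsetP[x _ ->].
- move=> a _.
  have hI : injective (fun x => (a, x) : lexprod G1 G2) by move=> x y [].
  have hE x y : edge ((a, x) : lexprod G1 G2) (a, y) = edge x y.
    by rewrite edge_lex eqxx edge_irrefl orbF.
  have he x y : free_rel ((a, x) : lexprod G1 G2) (a, y) -> free_rel x y by [].
  (* If the whole copy lay in [U a], any two of its vertices would be adjacent, one being later than
     the other. So some [x0] stays in place, and its colour goes to the moved vertices. *)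
  have [x0 x0U | allU] := pickP (predC (U a)); last first.
    case: G2nc => x y xy; have UE u v : rho (a, u) < rho (a, v) -> edge v u.
      by have /negbFE/forallP/(_ v)/implyP := allU u.
    case: (ltngtP (rho (a, x)) (rho (a, y))) => [/UE | /UE // | /rhoI [] E].
      by rewrite edge_sym.
    by rewrite E eqxx in xy.
  have lay_a := layout_induced hI hE he lay.
  apply: n2_le (layout_move_dominating x0 (fun x => rho_lt (a, x)) lay_a) _ => y /=.
  by apply/imsetP; case: ifP => Uy; [exists x0 | exists y; rewrite ?inE /= ?Uy].
- have aux a b x y : a \in K -> b \in K -> a != b -> rho (a, x) < rho (b, y) ->
    c (a, x) = c (b, y) -> U b y.
    move=> aK bK ab lt_xy cxy; apply/forallP=> z; apply/implyP=> lt_yz.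
    (* The vertex [(b, z)] is adjacent to [(a, x)] because [a] and [b] lie in the clique;
       consistency carries this over to [(b, y)]. *)
    have := cons _ _ _ lt_xy lt_yz cxy; rewrite !edge_lex eqxx edge_irrefl orbF.
    by apply; rewrite clK ?orbT // eq_sym.
  move=> a b aK bK _ /imsetP[x Ux ->] /imsetP[y Uy] cxy.
  (* For a colour shared by two copies, the later of the two vertices would belong to [U], against
     its choice. *)
  case: (eqVneq a b) => // ab; case: (ltngtP (rho (a, x)) (rho (b, y))) => [lt|lt|/rhoI[] //].
    by case/negP: Uy; apply: aux ab lt cxy.
  by case/negP: Ux; apply: aux lt (esym cxy); rewrite // eq_sym.
Qed.

End LexProductBounds.

Theorem theorem4p17 (G1 G2 : sgraph) :
  (* (i); vertex sets are nonempty by convention, which matters only here *)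
  (0 < #|G2| -> complete G2 ->
    [/\ thin (lexprod G1 G2) = thin G1,
        pthin (lexprod G1 G2) = pthin G1,
        compthin (lexprod G1 G2) = compthin G1
      & comppthin (lexprod G1 G2) = comppthin G1])
  /\ (* (ii) *)
  [/\ thin (lexprod G1 G2) <= indthin G1 * thin G2,
      indthin (lexprod G1 G2) <= indthin G1 * indthin G2,
      pthin (lexprod G1 G2) <= indpthin G1 * pthin G2
    & indpthin (lexprod G1 G2) <= indpthin G1 * indpthin G2]
  /\ (* (iii) *)
  (compthin (lexprod G1 G2) <= #|G1| * compthin G2 /\
   comppthin (lexprod G1 G2) <= #|G1| * comppthin G2)
  /\ (* (iv) *)
  (~ complete G2 ->
    [/\ clique_number G1 * thin G2 <= thin (lexprod G1 G2),
        clique_number G1 * indthin G2 <= indthin (lexprod G1 G2)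
      & clique_number G1 * indpthin G2 <= indpthin (lexprod G1 G2)]).
Proof.
split=> [G2_gt0 G2c|].
  have He (u v : lexprod G1 G2) : adjacent_or_eq u.1 v.1 -> adjacent_or_eq u v.
    case: u v => [a x] [b y] /= ab; apply/implyP; rewrite xpair_eqE edge_lex.
    case: (eqVneq a b) ab => [-> _ /= xy | ab /implyP -> //].
    by rewrite G2c.
  have He1 a b (x : G2) :
      adjacent_or_eq ((a, x) : lexprod G1 G2) (b, x) -> adjacent_or_eq a b.
    by rewrite /adjacent_or_eq xpair_eqE eqxx andbT edge_lex edge_irrefl andbF.
  (* For [thin] and [pthin] the class relation is [free_rel], so both transport conditions are
     trivial. *)
  by split; [ apply: lex_complete_eq (thin_min_layout _) (thin_min_layout _)
            | apply: lex_complete_eq (pthin_min_layout _) (pthin_min_layout _)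
            | apply: lex_complete_eq He He1 (compthin_min_layout _) (compthin_min_layout _)
            | apply: lex_complete_eq He He1 (comppthin_min_layout _) (comppthin_min_layout _)].
have He (u v : lexprod G1 G2) : ~~ edge u.1 v.1 -> nonadjacent u.2 v.2 -> nonadjacent u v.
  case: u v => [a x] [b y] /= ab; rewrite /nonadjacent edge_lex (negbTE ab) orbF.
  by move/negbTE ->; rewrite andbF.
split.
  split.
  - exact: lex_independent_leq (thin_min_layout _) (indthin_min_layout _) (thin_min_layout _).
  - exact: lex_independent_leq He (indthin_min_layout _) (indthin_min_layout _) (indthin_min_layout _).
  - exact: lex_independent_leq (pthin_min_layout _) (indpthin_min_layout _) (pthin_min_layout _).
  - exact: lex_independent_leq He (indpthin_min_layout _) (indpthin_min_layout _) (indpthin_min_layout _).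
split.
  split; first exact: lex_card_leq (compthin_min_layout _) (compthin_min_layout _).
  exact: lex_card_leq (comppthin_min_layout _) (comppthin_min_layout _).
move=> G2nc; split; first exact: clique_mul_thin_leq.
  exact: clique_mul_independent_leq (indthin_min_layout _) (indthin_min_layout _).
exact: clique_mul_independent_leq (indpthin_min_layout _) (indpthin_min_layout _).
Qed.
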